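(* Let $\Gamma$ be an infinite discrete abelian group and let $D=\Gamma^{\mathcal{D}}=|\mathcal{D}|$ be the universal distal (right topological group) compactification of $\Gamma$. Then the topological center of $D$, i.e. the set of $p\in D$ for which $L_p:D\to D$, $L_p(q)=pq$, is continuous, is equal to the algebraic center of the group $D$, i.e. $\{p\in D: pq=qp \text{ for all } q\in D\}$. Moreover, when $\Gamma=\mathbb{Z}$, this center also coincides with the canonical image of $\Gamma$ in $D$.
   Context: A dynamical system $(X,\Gamma)$ is a compact Hausdorff space $X$ with an action of the discrete group $\Gamma$ by homeomorphisms. It is distal if for all $x\neq x'$ in $X$ there is no net $(\gamma_\alpha)$ in $\Gamma$ such that $\gamma_\alpha x$ and $\gamma_\alpha x'$ converge to the same point. A function $f\in\ell^\infty(\Gamma)$ (complex valued) is distal if there are a distal system $(X,\Gamma)$, a point $x_0\in X$ and a continuous $F:X\to\mathbb{C}$ with $f(\gamma)=F(\gamma x_0)$ for all $\gamma\in\Gamma$. The distal functions form a closed $\Gamma$-invariant unital $*$-subalgebra $\mathcal{D}\subset\ell^\infty(\Gamma)$, and $D=|\mathcal{D}|$ denotes its Gelfand space (a compact Hausdorff space). The canonical map $\Gamma\to D$ sends $\gamma$ to the evaluation functional $f\mapsto f(\gamma)$ and has dense image. The action of $\Gamma$ on itself by left multiplication extends to an action of $\Gamma$ on $D$ by homeomorphisms. The multiplication on $D$ is the unique one such that for $\gamma\in\Gamma$ the product of the image of $\gamma$ with $q\in D$ is $\gamma q$ (the action of $\gamma$ on $q$), and such that for each $p\in D$ the right multiplication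 $R_p:q\mapsto qp$ is continuous on $D$. With this multiplication $D$ is a group, the canonical map $\Gamma\to D$ is a group homomorphism, and $D$ is the largest right topological group compactification of $\Gamma$ (a right topological group being a group with a topology for which all right multiplications $q\mapsto qp$ are continuous). *)

(* Defs.v *)
From HB Require Import structures.
From mathcomp Require Import all_boot all_order all_algebra.
From mathcomp Require Import all_classical all_reals all_analysis.

Set Implicit Arguments.
Unset Strict Implicit.
Unset Printing Implicit Defensive.

Import Order.TTheory GRing.Theory Num.Theory.
Import numFieldNormedType.Exports.

Local Open Scope classical_set_scope.
Local Open Scope ring_scope.

(* The (discrete, abelian) group Gamma is written additively.                 *)

(* Each [act g] is then a homeomorphism, with inverse [act (- g)].            *)
Record dynSystem (Gamma : zmodType) := DynSystem {
  space :> topologicalType;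
  space_compact : compact [set: space];
  space_hausdorff : hausdorff_space space;
  act : Gamma -> space -> space;
  act0 : forall x, act 0 x = x;
  actD : forall g h x, act (g + h) x = act g (act h x);
  act_continuous : forall g, continuous (act g)
}.

Definition directed (I : Type) (le : I -> I -> Prop) : Prop :=
  [/\ exists i : I, True,
      forall i, le i i,
      forall i j k, le i j -> le j k -> le i k &
      forall i j, exists2 k, le i k & le j k].

(* Convergence along this filter is convergence of nets indexed by [(I, le)]. *)
Definition tails (I : Type) (le : I -> I -> Prop) : set_system I :=
  [set A | exists i, forall j, le i j -> A j].

Definition distal_system (Gamma : zmodType) (X : dynSystem Gamma) : Prop :=
  forall x x' : X, x <> x' ->
    ~ exists (I : Type) (le : I -> I -> Prop) (g : I -> Gamma) (z : X),
        [/\ directed le,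
            (fun i => act (g i) x) @ tails le --> z &
            (fun i => act (g i) x') @ tails le --> z].

(* The field of scalars [C] carries the topology of its norm; it is meant to be
   instantiated with [R[i]] for [R : realType].                               *)
Definition distal_function (C : numClosedFieldType) (Gamma : zmodType) :
    set (Gamma -> C) :=
  [set f | exists (X : dynSystem Gamma) (x0 : X) (F : X -> C),
     [/\ distal_system X, continuous F & forall g, f g = F (act g x0)]].

Section DistalAlgebra.
Variables (C : numClosedFieldType) (Gamma : zmodType).
Implicit Types X Y : dynSystem Gamma.

(* A distal function is automatically in l^oo(Gamma). *)
Lemma distal_function_bounded (f : Gamma -> C) :
  distal_function f -> exists M : C, forall g, `|f g| <= M.
Proof.
move=> [X [x0 [F [_ Fc fE]]]].
have /compact_near_coveringP cX := @space_compact _ X.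
suff /filter_ex[M FM] : \forall M \near +oo, [set: X] `<=` (fun x => `|F x| <= M).
  by exists M => g; rewrite fE; exact: FM.
apply: cX => x _.
exists (F @^-1` ball (F x) 1, [set M | `|F x| + 1 <= M]).
  split=> /=; last by apply: nbhs_pinfty_ge; rewrite ger0_real ?addr_ge0.
  by apply: (Fc x); exact: nbhsx_ballx.
move=> [y M] /= [Fxy]; apply: le_trans.
rewrite -[F y](subrK (F x)) (le_trans (ler_normD _ _)) //.
by rewrite addrC lerD2l distrC ltW.
Qed.

Section Product.
Variables X Y : dynSystem Gamma.

Let pact (g : Gamma) (z : X * Y) : X * Y := (act g z.1, act g z.2).

Let pcompact : compact [set: X * Y].
Proof.
rewrite -setXTT; exact: compact_setX (@space_compact _ X) (@space_compact _ Y).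
Qed.

Let phausdorff : hausdorff_space (X * Y)%type.
Proof.
move=> [x y] [x' y'] /= cl; congr pair.
- apply: (@space_hausdorff _ X) => A B Ax Bx.
  have [] := cl (A `*` setT) (B `*` setT).
  + by exists (A, setT) => //=; split=> //; exact: filterT.
  + by exists (B, setT) => //=; split=> //; exact: filterT.
  by move=> [u v] /= [[? _] [? _]]; exists u.
- apply: (@space_hausdorff _ Y) => A B Ay By.
  have [] := cl (setT `*` A) (setT `*` B).
  + by exists (setT, A) => //=; split=> //; exact: filterT.
  + by exists (setT, B) => //=; split=> //; exact: filterT.
  by move=> [u v] /= [[_ ?] [_ ?]]; exists v.
Qed.

Let pact0 z : pact 0 z = z.
Proof. by case: z => x y; rewrite /pact /= !act0. Qed.

Let pactD g h z : pact (g + h) z = pact g (pact h z).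
Proof. by rewrite /pact !actD. Qed.

Let pact_continuous g : continuous (pact g).
Proof.
move=> [x y]; apply: cvg_pair => /=.
- by apply: (cvg_comp _ _ cvg_fst); exact: act_continuous.
- by apply: (cvg_comp _ _ cvg_snd); exact: act_continuous.
Qed.

Definition prod_system : dynSystem Gamma :=
  DynSystem pcompact phausdorff pact0 pactD pact_continuous.

Lemma prod_system_distal :
  distal_system X -> distal_system Y -> distal_system prod_system.
Proof.
move=> dX dY [x y] [x' y'] neq [I [le [g [[z w] [dir c c']]]]].
have [xx'|/eqP xx'] := pselect (x = x'); last first.
  apply: (dX x x'); first exact/eqP.
  exists I, le, g, z; split=> //.
  - exact: (cvg_comp _ _ c (@cvg_fst _ _ (nbhs z) (nbhs w) _)).
  - exact: (cvg_comp _ _ c' (@cvg_fst _ _ (nbhs z) (nbhs w) _)).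
apply: (dY y y'); first by move=> yy'; apply: neq; rewrite xx' yy'.
exists I, le, g, w; split=> //.
- exact: (cvg_comp _ _ c (@cvg_snd _ _ (nbhs z) (nbhs w) _)).
- exact: (cvg_comp _ _ c' (@cvg_snd _ _ (nbhs z) (nbhs w) _)).
Qed.

End Product.

Lemma distal_function_comp2 (op : C -> C -> C) (f f' : Gamma -> C) :
  (forall X (F F' : X -> C), continuous F -> continuous F' ->
     continuous (fun x => op (F x) (F' x))) ->
  distal_function f -> distal_function f' ->
  distal_function (fun g => op (f g) (f' g)).
Proof.
move=> opc [X [x [F [dX Fc fE]]]] [Y [y [F' [dY F'c f'E]]]].
exists (prod_system X Y), (x, y), (fun z => op (F z.1) (F' z.2)); split.
- exact: prod_system_distal.
- apply: (opc (prod_system X Y) (fun z => F z.1) (fun z => F' z.2)).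
  + by move=> [u v]; apply: (cvg_comp _ _ cvg_fst); exact: Fc.
  + by move=> [u v]; apply: (cvg_comp _ _ cvg_snd); exact: F'c.
- by move=> g; rewrite fE f'E.
Qed.

Lemma distal_function_cst (c : C) : distal_function (fun _ : Gamma => c).
Proof.
pose T := initial_topology (fun _ : unit => true).
have cT : compact [set: T].
  have -> : [set: T] = [set tt] by apply/seteqP; split=> [[]|].
  exact: compact_set1.
have hT : hausdorff_space T by move=> [] [].
pose X := @DynSystem Gamma T cT hT (fun _ x => x) (fun=> erefl)
  (fun _ _ _ => erefl) (fun _ x => cvg_id).
exists X, tt, (fun=> c); split=> //; first by move=> [] [].
exact: cst_continuous.
Qed.

Definition distal_pred : {pred Gamma -> C} :=
  mem (@distal_function C Gamma).

Lemma distal_subring_closed : subring_closed distal_pred.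
Proof.
split=> [|f f'|f f']; rewrite !inE.
- exact: distal_function_cst.
- apply: (@distal_function_comp2 (fun a b => a - b)) => X F F' Fc F'c x.
  by apply: cvgB; [exact: Fc | exact: F'c].
- apply: (@distal_function_comp2 (fun a b => a * b)) => X F F' Fc F'c x.
  by apply: cvgM; [exact: Fc | exact: F'c].
Qed.

HB.instance Definition _ :=
  GRing.isSubringClosed.Build (Gamma -> C) distal_pred
    distal_subring_closed.

Lemma distal_scaler_closed : scaler_closed distal_pred.
Proof.
move=> c f df.
have dc : (cst c : Gamma -> C) \in distal_pred.
  by rewrite inE; exact: distal_function_cst.
exact: rpredM dc df.
Qed.

HB.instance Definition _ :=
  GRing.isScaleClosed.Build C (Gamma -> C) distal_pred
    distal_scaler_closed.

Definition distal_alg := {f : Gamma -> C | f \in distal_pred}.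

HB.instance Definition _ := SubChoice.on distal_alg.
HB.instance Definition _ :=
  GRing.SubChoice_isSubComPzRing.Build (Gamma -> C) distal_pred distal_alg
    (subringClosedP _).
HB.instance Definition _ :=
  [SubZmodule_isSubLmodule of distal_alg by <:].

Definition is_character (p : distal_alg -> C) : Prop :=
  scalar p /\ GRing.monoid_morphism p.

(* The spectrum carries the topology of pointwise convergence on the algebra,
   see [pairing_continuous] and [gelfand_continuous].                         *)
Definition gelfand : Type :=
  [set p : {ptws distal_alg -> C} | is_character p].

HB.instance Definition _ := Topological.on gelfand.

Definition pairing (p : gelfand) (f : distal_alg) : C := sval p f.

Lemma pairing_character (p : gelfand) : is_character (pairing p).
Proof. exact: set_mem (svalP p). Qed.

Definition Gelfand (p : distal_alg -> C) (cp : is_character p) : gelfand :=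
  exist (fun p => p \in [set p | is_character p]) p (mem_set cp).

Lemma eval_is_character (g : Gamma) :
  is_character (fun f : distal_alg => sval f g).
Proof. by split. Qed.

Definition canonical_map (g : Gamma) : gelfand :=
  Gelfand (eval_is_character g).

Lemma translate_subproof (g : Gamma) (f : distal_alg) :
  (fun h => sval f (g + h)) \in distal_pred.
Proof.
have := valP f; rewrite !inE => -[X [x0 [F [dX Fc fE]]]].
exists X, x0, (F \o act g); split=> //.
- move=> x; apply: continuous_comp; [exact: act_continuous | exact: Fc].
- by move=> h /=; rewrite -actD -fE.
Qed.

Definition translate (g : Gamma) (f : distal_alg) : distal_alg :=
  exist (fun f => f \in distal_pred) _ (translate_subproof g f).

Lemma gelfand_act_subproof (g : Gamma) (p : gelfand) :
  is_character (fun f => pairing p (translate g f)).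
Proof.
have [plin [p1 pM]] := pairing_character p.
split; [move=> a f f' | split=> [|f f']].
- by rewrite -plin; congr (pairing p _); exact: val_inj.
- by rewrite -p1; congr (pairing p _); exact: val_inj.
- by rewrite -pM; congr (pairing p _); exact: val_inj.
Qed.

(* It extends left multiplication by [g], see [gelfand_act_canonical].        *)
Definition gelfand_act (g : Gamma) (p : gelfand) : gelfand :=
  Gelfand (gelfand_act_subproof g p).

Lemma gelfand_act_canonical g h :
  gelfand_act g (canonical_map h) = canonical_map (g + h).
Proof. exact: val_inj. Qed.

(* The range of [canonical_map] is dense in the Hausdorff space [gelfand], so at
   most one [mul] satisfies this; [gelfand_mul] below does, see [gelfand_mulP].*)
Definition is_gelfand_mul (mul : gelfand -> gelfand -> gelfand) : Prop :=
  (forall g q, mul (canonical_map g) q = gelfand_act g q) /\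
  (forall p, continuous (fun q => mul q p)).

Lemma continuous_conjC : continuous (Num.conj : C -> C).
Proof.
move=> z A [e e0 eA]; exists e => // w zw; apply: eA.
by rewrite /ball_ /= -rmorphB norm_conjC.
Qed.

Lemma orbit_fun_subproof X (dX : distal_system X) (x0 : X) (F : X -> C)
  (Fc : continuous F) : (fun g => F (act g x0)) \in distal_pred.
Proof. by rewrite inE; exists X, x0, F. Qed.

Definition orbit_fun X (dX : distal_system X) (x0 : X) (F : X -> C)
    (Fc : continuous F) : distal_alg :=
  exist (fun f => f \in distal_pred) _ (orbit_fun_subproof dX x0 Fc).

(* Every character of the algebra is evaluation at a point of [X].            *)
Lemma gelfand_point (q : gelfand) X (dX : distal_system X) (x0 : X) :
  exists y : X, forall (F : X -> C) (Fc : continuous F),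
    pairing q (orbit_fun dX x0 Fc) = F y.
Proof.
have [qlin [q1 qM]] := pairing_character q.
pose K := [set G : X -> C | (forall x, 0 <= (G x : C)) /\
  exists Gc : continuous G, pairing q (orbit_fun dX x0 Gc) = 0].
pose B (Ge : (X -> C) * C) := [set x | (Ge.1 x : C) < Ge.2].
pose S := [set Ge : (X -> C) * C | K Ge.1 /\ 0 < Ge.2].
have qD (f f' : distal_alg) : pairing q (f + f') = pairing q f + pairing q f'.
  by have := qlin 1 f f'; rewrite scale1r mul1r.
have q0 : pairing q (0 : distal_alg) = 0.
  by apply: (addrI (pairing q 0)); rewrite -qD !addr0.
have Bproper : ProperFilter (filter_from S B).
  apply: filter_from_proper; first apply: filter_from_filter.
  - exists (cst 0, 1); split=> //=; split=> //; exists (fun x => cvg_cst _).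
    by apply: etrans q0; congr (pairing q _); exact: val_inj.
  - move=> [G e] [G' e'] /= [[G0 [Gc qG]] e0] [[G'0 [G'c qG']] e'0].
    have GG'c : continuous (G + G').
      by move=> x; apply: cvgD; [exact: Gc | exact: G'c].
    exists (G + G', Order.min e e').
      split=> /=; last by rewrite /Order.min; case: ifP.
      split; first by move=> x; exact: addr_ge0.
      exists GG'c; have -> : orbit_fun dX x0 GG'c =
          orbit_fun dX x0 Gc + orbit_fun dX x0 G'c by exact: val_inj.
      by rewrite qD qG qG' addr0.
    have cmp : (e >=< e')%O by rewrite real_comparable // gtr0_real.
    move=> x; rewrite /B /= comparable_lt_min // => /andP[lt1 lt2].
    by split; [apply: le_lt_trans lt1; rewrite lerDl |
      apply: le_lt_trans lt2; rewrite lerDr].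
  - move=> [G e] /= [[G0 [Gc qG]] e0].
    apply: contrapT => Bempty.
    have eG x : e <= (G x : C).
      rewrite (real_leNgt (gtr0_real e0) (ger0_real (G0 x))).
      by apply/negP => ltGe; apply: Bempty; exists x.
    have Gn0 t : G t != 0 by rewrite gt_eqF // (lt_le_trans e0 (eG t)).
    have GVc : continuous (fun x => (G x)^-1).
      by move=> x; apply: cvgV; [exact: Gn0 | exact: Gc].
    have : pairing q (orbit_fun dX x0 Gc * orbit_fun dX x0 GVc) = 1.
      rewrite -q1; congr (pairing q _); apply: val_inj; apply/funext => g /=.
      exact: mulfV.
    by rewrite qM qG mul0r => /esym /eqP; rewrite oner_eq0.
have [y [_ yB]] := @space_compact _ X _ Bproper filterT.
exists y => F Fc; set c := pairing q _.
pose H x : C := F x - c.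
have Hc : continuous H by move=> x; apply: cvgB; [exact: Fc | exact: cvg_cst].
pose G x : C := H x * (H x)^*.
have HJc : continuous (fun x => (H x)^*).
  move=> x; exact: continuous_comp (Hc x) (@continuous_conjC _).
have Gc : continuous G.
  by move=> x; apply: cvgM; [exact: Hc | exact: HJc].
have GE x : G x = `|F x - c : C| ^+ 2 by rewrite normCK.
have qH : pairing q (orbit_fun dX x0 Hc) = 0.
  have := qlin (- c) 1 (orbit_fun dX x0 Fc).
  rewrite q1 -/c /= mulr1 addNr => <-; congr (pairing q _).
  apply: val_inj; apply/funext => g.
  by transitivity (- c * 1 + F (act g x0)) => //; rewrite mulr1 addrC.
have KG : K G.
  split=> [x|]; first by rewrite GE exprn_ge0.
  exists Gc; have -> : orbit_fun dX x0 Gc =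
      orbit_fun dX x0 Hc * orbit_fun dX x0 HJc by exact: val_inj.
  by rewrite qM qH mul0r.
apply/esym/eqP; rewrite -subr_eq0; apply/negPn/negP => Hy.
pose e : C := `|F y - c : C|.
have e0 : 0 < e by rewrite normr_gt0.
have e2 : 0 < e / 2 by rewrite divr_gt0.
have S2 : filter_from S B (B (G, (e / 2) ^+ 2)).
  by exists (G, (e / 2) ^+ 2) => //; split=> //; exact: exprn_gt0.
have N2 : nbhs y (F @^-1` ball (F y) (e / 2)).
  by apply: (Fc y); exact: nbhsx_ballx.
have [x []] := yB _ _ S2 N2.
rewrite /B /= GE ltr_pXn2r ?nnegrE ?(ltW e2) // => lt1 lt2.
have : e < e / 2 + e / 2.
  rewrite {1}/e -(subrK (F x) (F y)) -addrA (le_lt_trans (ler_normD _ _)) //.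
  exact: ltrD.
by rewrite -splitr ltxx.
Qed.

Lemma pairing_continuous (f : distal_alg) :
  continuous (fun p : gelfand => pairing p f).
Proof.
move=> p; apply: (@continuous_comp _ _ _ (sval : gelfand -> {ptws distal_alg -> C})
  (fun u => u f)).
- exact: initial_continuous.
- exact: (@proj_continuous distal_alg (fun=> C) f).
Qed.

Lemma gelfand_continuous (T : topologicalType) (h : T -> gelfand) :
  (forall f, continuous (fun t => pairing (h t) f)) -> continuous h.
Proof.
move=> hc; apply: continuous_comp_initial => t.
apply/cvg_sup => f.
apply: (@continuous_comp_initial {ptws distal_alg -> C} T C (fun u => u f)).
exact: hc.
Qed.

Lemma convolution_subproof (q : gelfand) (f : distal_alg) :
  (fun g => pairing q (translate g f)) \in distal_pred.
Proof.
have := svalP f; rewrite !inE => -[X [x0 [F [dX Fc fE]]]].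
have [y yE] := gelfand_point q dX x0.
exists X, y, F; split=> // g.
have Fgc : continuous (F \o act g).
  move=> x; apply: continuous_comp; [exact: act_continuous | exact: Fc].
rewrite -[RHS]/((F \o act g) y) -(yE _ Fgc); congr (pairing q _).
by apply: val_inj; apply/funext => h /=; rewrite fE actD.
Qed.

Definition convolution (q : gelfand) (f : distal_alg) : distal_alg :=
  exist (fun f => f \in distal_pred) _ (convolution_subproof q f).

Lemma gelfand_mul_subproof (p q : gelfand) :
  is_character (fun f => pairing p (convolution q f)).
Proof.
have [plin [p1 pM]] := pairing_character p.
have tlin g a (f f' : distal_alg) :
    translate g (a *: f + f') = a *: translate g f + translate g f'.
  exact: val_inj.
have tM g (f f' : distal_alg) :
    translate g (f * f') = translate g f * translate g f'.
  exact: val_inj.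
have t1 g : translate g 1 = 1 by exact: val_inj.
have [qlin [q1 qM]] := pairing_character q.
split; [move=> a f f' | split=> [|f f']].
- rewrite -plin; congr (pairing p _); apply: val_inj; apply/funext => g.
  by rewrite /= tlin qlin.
- rewrite -p1; congr (pairing p _); apply: val_inj; apply/funext => g.
  by rewrite /= t1 q1.
- rewrite -pM; congr (pairing p _); apply: val_inj; apply/funext => g.
  by rewrite /= tM qM.
Qed.

Definition gelfand_mul (p q : gelfand) : gelfand :=
  Gelfand (gelfand_mul_subproof p q).

Lemma gelfand_mulP : is_gelfand_mul gelfand_mul.
Proof.
split=> [g q|p]; first exact: val_inj.
by apply: gelfand_continuous => f; exact: pairing_continuous.
Qed.

Definition topological_center (mul : gelfand -> gelfand -> gelfand) :
    set gelfand :=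
  [set p | continuous (mul p)].

Definition algebraic_center (mul : gelfand -> gelfand -> gelfand) :
    set gelfand :=
  [set p | forall q, mul p q = mul q p].

End DistalAlgebra.

(* Main.v *)
From HB Require Import structures.
Require Import Defs.
From mathcomp Require Import all_boot all_order all_algebra.
From mathcomp Require Import all_classical all_reals all_analysis.
From mathcomp Require Import ring lra zify.
From mathcomp.real_closed Require Import complex.

(* The image of Gamma is dense in D, so a continuous self-map of D is
   determined by its restriction to Gamma. As Gamma is abelian its image is
   central, hence if [L_p] is continuous then [L_p] and [R_p] agree on Gamma
   and therefore on D; conversely, for p central [L_p = R_p] is continuous.

   For Gamma = Z, let p be central and suppose that [y = p x] is not on the
   orbit of x in some distal system X. For a continuous [phi] from X to the
   circle, the skew product [(w, u) |-> (T w, phi(w) u)] is distal. Comparing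
   [p q] and [q p] on it shows that if n_k and m_k are times along which
   [T^(n_k) x] and [T^(m_k) x] have the same limit, then the products of
   [phi(T^i y) / phi(T^i x)] over [n_k <= i < m_k] accumulate at 1. Since the two
   orbits are disjoint, a gliding hump construction gives a [phi] for which
   these products stay away from 1. So p acts as some power [T^n] on x;
   adjoining to X the rotation by (3 + 4i) / 5, which is not a root of unity,
   shows that n does not depend on X. *)

Set Implicit Arguments.
Unset Strict Implicit.
Unset Printing Implicit Defensive.

Import Order.TTheory GRing.Theory Num.Theory.
Import numFieldNormedType.Exports.

Local Open Scope classical_set_scope.
Local Open Scope ring_scope.
Local Open Scope complex_scope.

(** * Density of the canonical image *)

Lemma cvg_initial (S : choiceType) (T : topologicalType) (f : S -> T)
    (F : set_system S) (FF : Filter F) (s : initial_topology f) :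
  f @ F --> f s -> F --> s.
Proof.
move=> Ff A [? /= [[W oW <-]] Ws /filterS]; apply.
exact: Ff (open_nbhs_nbhs (conj oW Ws)).
Qed.

Section Density.
Variables (C : numClosedFieldType) (Gamma : zmodType).
Local Notation D := (gelfand C Gamma).
Local Notation alg := (distal_alg C Gamma).

Lemma gelfand_ext (p q : D) : (forall f, pairing p f = pairing q f) -> p = q.
Proof. by move=> pq; apply: val_inj; apply/funext. Qed.

Lemma gelfand_cvg (T : Type) (F : set_system T) (FF : Filter F)
    (h : T -> D) (q : D) :
  (forall f, (fun t => pairing (h t) f) @ F --> pairing q f) -> h @ F --> q.
Proof.
move=> hq; apply: cvg_initial; apply/cvg_sup => f; apply: cvg_initial.
exact: hq.
Qed.

Lemma pairingE (g : Gamma) (f : alg) : pairing (canonical_map C g) f = sval f g.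
Proof. by []. Qed.

Lemma pairingD (q : D) f f' : pairing q (f + f') = pairing q f + pairing q f'.
Proof.
have [qlin _] := pairing_character q.
by have := qlin 1 f f'; rewrite scale1r mul1r.
Qed.

Lemma pairingM (q : D) f f' : pairing q (f * f') = pairing q f * pairing q f'.
Proof. by have [_ []] := pairing_character q. Qed.

Lemma pairing1 (q : D) : pairing q 1 = 1.
Proof. by have [_ []] := pairing_character q. Qed.

Lemma pairing0 (q : D) : pairing q 0 = 0.
Proof. by apply: (addrI (pairing q 0)); rewrite -pairingD !addr0. Qed.

Lemma pairingZ (q : D) a f : pairing q (a *: f) = a * pairing q f.
Proof.
have [qlin _] := pairing_character q.
by have := qlin a f 0; rewrite pairing0 !addr0.
Qed.

Lemma distal_function_postcomp (phi : C -> C) (f : Gamma -> C) :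
  continuous phi -> distal_function f -> distal_function (phi \o f).
Proof.
move=> phic [X [x0 [F [dX Fc fE]]]]; exists X, x0, (phi \o F); split=> //.
- by move=> x; exact: (continuous_comp (Fc x) (phic (F x))).
- by move=> g /=; rewrite fE.
Qed.

Definition postcomp (phi : C -> C) (phic : continuous phi) (f : alg) : alg :=
  exist (fun f => f \in @distal_pred C Gamma) _
    (mem_set (distal_function_postcomp phic (set_mem (svalP f)))).

(* [2 / (`|z| + e + `| `|z| - e |)] is [(max `|z| e)^-1]: composing with it a
   distal function [f >= e] gives an inverse of [f] in the algebra. *)
Lemma continuous_max_inv (T : topologicalType) (F : T -> C) (e : C) : 0 < e ->
  continuous F ->
  continuous (fun x => 2 / ((`|F x| : C) + e + (`| (`|F x| : C) - e | : C))).
Proof.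
move=> e0 Fc x; pose nrm (w : C) : C := `|w|.
have nc (G : T -> C) : continuous G -> continuous (nrm \o G).
  by move=> Gc y; exact: (continuous_comp (Gc y) (@norm_continuous C C (G y))).
have cc : continuous (fun _ : T => e) by move=> y; exact: cvg_cst.
apply: cvgM; first exact: cvg_cst.
apply: cvgV.
  by rewrite gt_eqF // (lt_le_trans e0) // addrAC lerDr addr_ge0 ?normr_ge0.
apply: cvgD.
  by apply: cvgD; [exact: nc Fc x | exact: cc].
apply: (nc (fun y => nrm (F y) - e)) => y.
by apply: cvgB; [exact: nc Fc y | exact: cc].
Qed.

(** If [f >= e] everywhere, then [f] is invertible in the algebra, and a character cannot kill a
    unit. *)
Lemma pairing_eq0_small (q : D) (f : alg) (e : C) :
  (forall g, 0 <= sval f g) -> pairing q f = 0 -> 0 < e ->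
  exists g, sval f g < e.
Proof.
move=> f0 qf e0; apply: contrapT => nex.
have fe g : e <= sval f g.
  rewrite (real_leNgt (gtr0_real e0) (ger0_real (f0 g))).
  by apply/negP => fge; apply: nex; exists g.
have ic := continuous_max_inv (F := id) e0 (fun=> cvg_id).
have : pairing q (f * postcomp ic f) = 1.
  apply: etrans (pairing1 q); congr (pairing q _); apply: val_inj.
  apply/funext => g.
  suff H : sval f g * (2 / (`|sval f g| + e + `| `|sval f g| - e |)) = 1 by [].
  rewrite (ger0_norm (f0 g)) ger0_norm ?subr_ge0 //.
  have fg0 : sval f g != 0 by rewrite gt_eqF // (lt_le_trans e0).
  rewrite addrACA subrr addr0; field.
  by rewrite -mulr2n mulrn_eq0.
by rewrite pairingM qf mul0r => /esym/eqP; rewrite oner_eq0.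
Qed.

Definition vanishing (q : D) : set alg :=
  [set f | (forall g, 0 <= sval f g) /\ pairing q f = 0].

(** Encodes the density of the image of [Gamma]: nonnegative functions in the kernel of [q] take
    arbitrarily small values, and their sublevel sets generate a filter on [Gamma] whose image tends
    to [q]. *)
Definition approach (q : D) : set_system Gamma :=
  filter_from [set fe : alg * C | vanishing q fe.1 /\ 0 < fe.2]
    (fun fe => [set g | sval fe.1 g < fe.2]).

Lemma approach_proper (q : D) : ProperFilter (approach q).
Proof.
apply: filter_from_proper; last first.
  by move=> [f e] /= [[f0 qf] e0]; have [g] := pairing_eq0_small f0 qf e0;
    exists g.
apply: filter_from_filter.
  exists (0, 1); split; last exact: ltr01.
  by split=> [g|]; [exact: (lexx (0 : C)) | exact: pairing0].
move=> [f e] [f' e'] /= [[f0 qf] e0] [[f'0 qf'] e'0].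
exists (f + f', Order.min e e').
  split; last by rewrite /= /Order.min; case: ifP.
  split; last by rewrite /= pairingD qf qf' addr0.
  by move=> g; exact: (addr_ge0 (f0 g) (f'0 g)).
have cmp : (e >=< e')%O by rewrite real_comparable // gtr0_real.
move=> g /=; rewrite comparable_lt_min // => /andP[lt1 lt2].
by split; [apply: le_lt_trans lt1; rewrite lerDl |
           apply: le_lt_trans lt2; rewrite lerDr].
Qed.

(** The function [|f - pairing q f|^2] is nonnegative and killed by [q]; where it is below [e ^+ 2],
    [f] is within [e] of [pairing q f]. *)
Lemma approach_cvg (q : D) : @canonical_map C Gamma @ approach q --> q.
Proof.
have FF := approach_proper q.
apply: gelfand_cvg => f; apply/cvgrPdist_lt => e e0.
set c := pairing q f.
pose H : alg := f + (- c) *: (1 : alg).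
pose K : alg := H * postcomp (@continuous_conjC C) H.
have HE g : sval H g = sval f g - c.
  by transitivity (sval f g + - c * 1) => //; rewrite mulr1.
have KE g : sval K g = `|sval f g - c| ^+ 2.
  by rewrite -HE normCK.
have e2 : 0 < e ^+ 2 by rewrite exprn_gt0.
exists (K, e ^+ 2).
  split=> //; split=> [g|].
    have K0 : 0 <= sval K g by rewrite KE exprn_ge0.
    exact: K0.
  apply: etrans (pairingM q H _) _.
  by rewrite /H pairingD pairingZ pairing1 mulr1 subrr mul0r.
move=> g Kg; have {}Kg : sval K g < e ^+ 2 by [].
rewrite KE in Kg; rewrite pairingE distrC.
by rewrite -(ltr_pXn2r (n := 2)) ?nnegrE // ltW.
Qed.

Lemma continuous_gelfand_ext (L L' : D -> D) :
  continuous L -> continuous L' ->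
  (forall g, L (canonical_map C g) = L' (canonical_map C g)) -> L = L'.
Proof.
move=> Lc L'c LL'; apply/funext => q; apply: gelfand_ext => f.
have FF := approach_proper q.
have cv (M : D -> D) : continuous M ->
    (fun g => pairing (M (canonical_map C g)) f) @ approach q --> pairing (M q)
      f.
  move=> Mc; have cM := cvg_comp _ _ (approach_cvg (q:=q)) (Mc q).
  exact: (cvg_comp _ _ cM (@pairing_continuous C Gamma f (M q))).
apply: (cvg_unique (@norm_hausdorff _ C) (cv _ Lc)).
by move: (cv _ L'c); under eq_fun do rewrite -LL'.
Qed.

Lemma gelfand_act_continuous g : continuous (@gelfand_act C Gamma g).
Proof. by apply: gelfand_continuous => f; exact: pairing_continuous. Qed.

(** * Uniqueness of the multiplication and its two centers *)

Section Mul.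
Variable mul : D -> D -> D.
Hypothesis mulP : is_gelfand_mul mul.

(** For fixed [q] both products are continuous in [p] and agree on the image of [Gamma]; this makes
    the convolution formula available for [mul]. *)
Lemma mulE p q : mul p q = gelfand_mul p q.
Proof.
have [m1 m2] := mulP; have [n1 n2] := gelfand_mulP C Gamma.
suff H : mul^~ q = (@gelfand_mul C Gamma)^~ q by exact: (congr1 (@^~ p) H).
by apply: continuous_gelfand_ext => // g; rewrite m1 n1.
Qed.

(** Both sides are continuous in [q], the left one being the action of [g], and they agree on the
    image of [Gamma] by commutativity. *)
Lemma mul_canonicalC g q :
  mul (canonical_map C g) q = mul q (canonical_map C g).
Proof.
have [m1 m2] := mulP.
suff H : mul (canonical_map C g) = mul^~ (canonical_map C g).
  exact: (congr1 (@^~ q) H).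
apply: continuous_gelfand_ext => //.
  have -> : mul (canonical_map C g) = gelfand_act g by apply/funext => r.
  exact: gelfand_act_continuous.
by move=> h; rewrite !m1 !gelfand_act_canonical addrC.
Qed.

Lemma canonical_map_central :
  range (@canonical_map C Gamma) `<=` algebraic_center mul.
Proof. by move=> _ [g _ <-] q; exact: mul_canonicalC. Qed.

Lemma topological_center_algebraic :
  topological_center mul = algebraic_center mul.
Proof.
have [m1 m2] := mulP; apply/seteqP; split=> p /= pc.
  move=> q; suff H : mul p = mul^~ p by exact: (congr1 (@^~ q) H).
  by apply: continuous_gelfand_ext => // g; rewrite -mul_canonicalC.
rewrite /topological_center /=.
have -> : mul p = mul^~ p by apply/funext => q; exact: pc.
exact: m2.
Qed.

End Mul.
End Density.

(** * Circle-valued cocycles and skew products *)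

Section ComplexPlane.
Variable R : realType.
Local Notation C := (R[i] : numClosedFieldType).

Lemma continuous_real_complex (T : topologicalType) (f : T -> R) :
  continuous f -> continuous (fun x => (f x)%:C : C).
Proof.
move=> fc x; apply/(@cvgrPdist_lt C C) => e e0.
have eE : e = (complex.Re e)%:C by rewrite RRe_real // gtr0_real.
rewrite eE ltcR in e0.
have := fc x; move/cvgrPdist_lt => /(_ _ e0).
apply: filterS => y xy; rewrite eE -rmorphB /=.
by rewrite normc_def /= expr0n addr0 sqrtr_sqr ltcR.
Qed.

Lemma continuous_complex (T : topologicalType) (f g : T -> R) :
  continuous f -> continuous g -> continuous (fun x => (f x +i* g x : C)).
Proof.
move=> fc gc x.
have -> : (fun x => (f x +i* g x : C)) = (fun x => (f x)%:C + 'i%C * (g x)%:C).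
  by apply/funext => y; rewrite [LHS]complexE.
apply: cvgD; first exact: continuous_real_complex fc x.
by apply: cvgM; [exact: cvg_cst | exact: continuous_real_complex gc x].
Qed.

(** The circle is closed and lies in the continuous image of a compact square. *)
Lemma compact_unit_circle : compact [set z : C | `|z| = 1].
Proof.
pose f (ab : R * R) : C := ab.1 +i* ab.2.
pose K : set (R * R) := `[-1, 1] `*` `[-1, 1].
have fc : continuous f.
  by apply: continuous_complex => x; [exact: cvg_fst | exact: cvg_snd].
have cK : compact (f @` K).
  apply: continuous_compact; first exact: continuous_subspaceT.
  by apply: compact_setX; exact: segment_compact.
apply: (subclosed_compact _ cK).
  have nc : continuous (fun z : C => `|z| : C) by move=> z;
    exact: (@norm_continuous C C).
  have -> : [set z : C | `|z| = 1] = (fun z : C => `|z| : C) @^-1` [set 1] by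
    [].
  apply: closed_comp; first by move=> z _; exact: nc.
  exact: (accessible_closed_set1 (hausdorff_accessible (@norm_hausdorff _ C))).
move=> z /= z1; exists (complex.Re z, complex.Im z); last by case: z {z1}.
have := z1; rewrite normc_def => -[] /(congr1 (fun x => x ^+ 2)).
rewrite sqr_sqrtr ?addr_ge0 ?sqr_ge0 // expr1n => nz.
by split; rewrite /= in_itv /=; apply/andP; split; nra.
Qed.

End ComplexPlane.

Section Circle.
Variable C : numClosedFieldType.

Definition circle : Type := [set z : C | `|z| = 1].
HB.instance Definition _ := Topological.on circle.

Lemma circle_norm (w : circle) : `|sval w| = 1.
Proof. exact: set_mem (svalP w). Qed.

Lemma circle_neq0 (w : circle) : sval w != 0.
Proof. by rewrite -normr_gt0 circle_norm. Qed.

Definition Circle (z : C) (z1 : `|z| = 1) : circle :=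
  exist (fun z => z \in [set z : C | `|z| = 1]) z (mem_set z1).

Lemma continuous_circle (T : topologicalType) (h : T -> circle) :
  continuous (fun t => sval (h t)) -> continuous h.
Proof. by move=> hc; apply: continuous_comp_initial => t; exact: hc. Qed.

Lemma continuous_sval : continuous (sval : circle -> C).
Proof. exact: initial_continuous. Qed.

Hypothesis compactC : compact [set z : C | `|z| = 1].

Lemma circle_compact : compact [set: circle].
Proof.
move=> F FF _.
have sF1 : F (sval @^-1` [set z : C | `|z| = 1]).
  by apply: filterE => w; exact: circle_norm.
have [z [z1 cz]] := @compactC (sval @ F) (fmap_proper_filter _ FF) sF1.
exists (Circle z1); split=> // A B FA [? /= [[W oW <-]] Wz WB].
have FA' : F (sval @^-1` (sval @` A)).
  by apply: filterS FA => w Aw; exists w.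
have [_ [[w Aw <-] Ww]] := cz _ _ FA' (open_nbhs_nbhs (conj oW Wz)).
by exists w; split=> //; exact: WB.
Qed.

Lemma circle_hausdorff : hausdorff_space circle.
Proof.
move=> u v cl; apply: val_inj; apply: (@norm_hausdorff _ C) => A B Au Bv.
have [w [Aw Bw]] := cl _ _ (continuous_sval Au) (continuous_sval Bv).
by exists (sval w).
Qed.

(** The action is trivial; the product with [X] supplies compactness and the Hausdorff property of
    the space of [skew_product]. *)
Definition circle_system : dynSystem int :=
  @DynSystem int circle circle_compact circle_hausdorff (fun _ x => x)
    (fun=> erefl) (fun _ _ _ => erefl) (fun _ x => cvg_id).

Section Cocycle.
Variables (X : dynSystem int) (phi : X -> circle).
Hypothesis phic : continuous phi.

(** [Negz i] is [- (i + 1)]: the negative branch inverts the product over the times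
    [-1, ..., -(n + 1)], as [cocycleD] forces. *)
Definition cocycle (n : int) (x : X) : C :=
  match n with
  | Posz n => \prod_(i < n) sval (phi (act (Posz i) x))
  | Negz n => (\prod_(i < n.+1) sval (phi (act (Negz i) x)))^-1
  end.

Lemma cocycle0 x : cocycle 0 x = 1.
Proof. by rewrite /= big_ord0. Qed.

Lemma cocycleS n x : cocycle (n + 1) x = cocycle n x * sval (phi (act n x)).
Proof.
case: n => [n|[|n]].
- by rewrite -PoszD addn1 /= big_ord_recr.
- rewrite (_ : Negz 0 + 1 = 0) // cocycle0 /= big_ord_recr big_ord0 /= mul1r.
  by rewrite mulVf // circle_neq0.
- have -> : Negz n.+1 + 1 = Negz n by lia.
  rewrite /= [in RHS]big_ord_recr /= invfM mulrAC -mulrA mulrV ?mulr1 //.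
  by rewrite unitfE circle_neq0.
Qed.

Lemma cocycleB n x :
  cocycle (n - 1) x = cocycle n x * (sval (phi (act (n - 1) x)))^-1.
Proof.
rewrite -{2}(subrK 1 n) cocycleS -mulrA mulrV ?mulr1 //.
by rewrite unitfE circle_neq0.
Qed.

(** This cocycle identity is what makes [skew_act] an action. *)
Lemma cocycleD m n x : cocycle (m + n) x = cocycle n x * cocycle m (act n x).
Proof.
elim/int_ind: m => [|m IH|m IH].
- by rewrite add0r cocycle0 mulr1.
- have -> : m.+1%:Z + n = m%:Z + n + 1 by lia.
  have -> : m.+1%:Z = m%:Z + 1 by lia.
  by rewrite !cocycleS IH actD mulrA.
- have -> : - m.+1%:Z + n = - m%:Z + n - 1 by lia.
  have -> : - m.+1%:Z = - m%:Z - 1 by lia.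
  rewrite !cocycleB IH mulrA -actD; congr (_ * (sval (phi (act _ _)))^-1).
  by lia.
Qed.

Lemma cocycle_norm n x : `|cocycle n x| = 1.
Proof.
by case: n => n; rewrite /= ?normfV normr_prod big1 ?invr1 // => i _;
  exact: circle_norm.
Qed.

Lemma continuous_cocycle n : continuous (cocycle n).
Proof.
have pc m : continuous (fun x : X => sval (phi (act m x))).
  move=> x; have H := cvg_comp _ _ (@act_continuous _ X m x) (@phic (act m x)).
  exact: (cvg_comp _ _ H (@continuous_sval (phi (act m x)))).
elim/int_ind: n => [|m IH|m IH] x.
- by rewrite (_ : cocycle 0 = cst 1); [exact: cvg_cst | apply/funext/cocycle0].
- have -> : m.+1%:Z = m%:Z + 1 by lia.
  rewrite (_ : cocycle (m%:Z + 1) =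
    fun x => cocycle m%:Z x * sval (phi (act m%:Z x))); last first.
    by apply/funext => y; exact: cocycleS.
  by apply: cvgM; [exact: IH | exact: pc].
- have -> : - m.+1%:Z = - m%:Z - 1 by lia.
  rewrite (_ : cocycle (- m%:Z - 1) =
    fun x => cocycle (- m%:Z) x * (sval (phi (act (- m%:Z - 1) x)))^-1);
      last first.
    by apply/funext => y; exact: cocycleB.
  by apply: cvgM; [exact: IH | apply: cvgV; [exact: circle_neq0 | exact: pc]].
Qed.

Lemma skew_circle n (z : X * circle) : `|cocycle n z.1 * sval z.2| = 1.
Proof. by rewrite normrM cocycle_norm circle_norm mulr1. Qed.

Definition skew_act (n : int) (z : X * circle) : X * circle :=
  (act n z.1, Circle (skew_circle n z)).

Lemma skew_act0 z : skew_act 0 z = z.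
Proof.
case: z => x w; rewrite /skew_act act0; congr pair; apply: val_inj.
by rewrite /= big_ord0 mul1r.
Qed.

Lemma skew_actD m n z : skew_act (m + n) z = skew_act m (skew_act n z).
Proof.
case: z => x w; rewrite /skew_act actD; congr pair; apply: val_inj.
have key (a b c : C) : a * b * c = b * (a * c) by rewrite -mulrA mulrCA.
rewrite [LHS]/(cocycle (m + n) x * sval w) cocycleD; exact: key.
Qed.

Lemma continuous_skew_act n : continuous (skew_act n).
Proof.
have sc : continuous (fun z => Circle (skew_circle n z)).
  apply: continuous_circle => -[x w]; apply: cvgM.
    by apply: (cvg_comp _ _ cvg_fst); exact: continuous_cocycle.
  by apply: (cvg_comp _ _ cvg_snd); exact: continuous_sval.
have fc : continuous (fun z : X * circle => act n z.1).
  by move=> [x w]; apply: (cvg_comp _ _ cvg_fst); exact: act_continuous.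
by move=> z; exact: (cvg_pair (fc z) (sc z)).
Qed.

Definition skew_product : dynSystem int :=
  DynSystem (@space_compact _ (prod_system X circle_system))
    (@space_hausdorff _ (prod_system X circle_system))
    skew_act0 skew_actD continuous_skew_act.

(** Points over distinct base points are kept apart by distality of [X]. Over a common base point
    both fibre coordinates are multiplied by the same unimodular number, so their distance is
    constant along the net. *)
Lemma skew_distal : distal_system X -> distal_system skew_product.
Proof.
move=> dX [x w] [x' w'] neq [I [le [g [[z v] [dir c c']]]]].
have [xx'|/eqP xx'] := pselect (x = x'); last first.
  apply: (dX x x'); first exact/eqP.
  exists I, le, g, z; split=> //.
  - exact: (cvg_comp _ _ c (@cvg_fst _ _ (nbhs z) (nbhs v) _)).
  - exact: (cvg_comp _ _ c' (@cvg_fst _ _ (nbhs z) (nbhs v) _)).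
(* The tails of a directed order form a proper filter, so limits along them are unique. *)
have FF : ProperFilter (tails le).
  case: dir => [[i0 _] rfl tr ub]; split; first by case=> i /(_ i (rfl i)).
  split; first by exists i0.
  - move=> A B [i iA] [j jB]; have [k ik jk] := ub i j.
    by exists k => l kl; split; [apply: iA | apply: jB]; exact: tr kl.
  - by move=> A B AB [i iA]; exists i => j /iA/AB.
subst x'; apply: neq; congr pair; apply: val_inj.
have snd (u : circle) :
    (fun i => act (g i) ((x, u) : skew_product)) @ tails le
      --> ((z, v) : skew_product) ->
    (fun i => cocycle (g i) x * sval u) @ tails le --> sval v.
  move=> cu.
  have H : (fun i => (act (g i) ((x, u) : skew_product)).2) @ tails le --> v.
    exact: (cvg_comp _ _ cu (@cvg_snd _ _ (nbhs z) (nbhs v) _)).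
  exact: (cvg_comp _ _ H (@continuous_sval v)).
have cB := @cvgB _ _ _ _ FF _ _ _ _ (snd _ c) (snd _ c').
have := @cvg_norm _ _ _ _ FF _ _ cB; rewrite subrr normr0 => c0.
have cw : (fun=> `|sval w - sval w'| : C) @ tails le --> (0 : C).
  suff <- : (fun i => `|cocycle (g i) x * sval w - cocycle (g i) x * sval w'|
    : C) = (fun=> `|sval w - sval w'|) by exact: c0.
  by apply/funext => i; rewrite -mulrBr normrM cocycle_norm mul1r.
have /eqP : (`|sval w - sval w'| : C) = 0.
  exact: (cvg_unique (@norm_hausdorff _ C) (cvg_cst _) cw).
by rewrite normr_eq0 subr_eq0 => /eqP.
Qed.

End Cocycle.
End Circle.

(** * The gliding hump *)

Section GlidingHump.
Variable R : realType.

Lemma cos_lipschitz (a b : R) : `|cos a - cos b| <= `|a - b|.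
Proof.
wlog ab : a b / b <= a.
  move=> H; have [|/ltW] := leP b a; first exact: H.
  by move=> /H; rewrite distrC [X in _ <= X]distrC.
have [c _ ->] : exists2 c, c \in `[b, a]%R & cos a - cos b = - sin c * (a - b).
  apply: MVT_segment => //; apply/continuous_subspaceT => x.
  exact: continuous_cos.
by rewrite normrM normrN ler_piMl // sin_max.
Qed.

(** * Uniform limits with geometrically decreasing increments *)

Section UniformLimit.
Variables (T : topologicalType) (H : nat -> T -> R) (c : nat -> R).
Hypothesis c0 : forall k, 0 <= c k.
Hypothesis c2 : forall k, 2 * c k.+1 <= c k.
Hypothesis Hc : forall k x, `|H k.+1 x - H k x| <= c k.

Let telescope k d x : `|H (k + d)%N x - H k x| <= 2 * c k.
Proof.
elim: d k => [|d IH] k.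
  by rewrite addn0 subrr normr0; have := c0 k; lra.
have := IH k.+1; rewrite addSnnS => {}IH.
have := Hc k x; have := c2 k.
have := ler_distD (H k.+1 x) (H (k + d.+1)%N x) (H k x).
lra.
Qed.

(** This harmonic bound is weaker than the geometric one but suffices for [c] to tend to 0; it
    propagates because [k + 2 <= 2 (k + 1)]. *)
Let c_small k : c k <= c 0 / k.+1%:R.
Proof.
elim: k => [|k IH]; first by rewrite divr1.
rewrite ler_pdivlMr // in IH; rewrite ler_pdivlMr //.
have := c2 k; have := c0 k.+1; have := c0 k.
have -> : k.+2%:R = k.+1%:R + 1 :> R by rewrite -natr1.
have : (1 : R) <= k.+1%:R by rewrite ler1n.
by nra.
Qed.

Lemma small_index (e : R) : 0 < e -> exists k, c k < e.
Proof.
move=> e0; have : 0 < e / (c 0 + 1) by rewrite divr_gt0 // ltr_wpDl.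
set d := e / _ => d0.
have [k _ /(_ k (leqnn k)) /= kd] := near_infty_natSinv_lt (PosNum d0).
exists k; apply: (le_lt_trans (c_small k)).
have := c0 0; rewrite le_eqVlt => /predU1P[<-|c00]; first by rewrite mul0r.
apply: (@lt_le_trans _ _ (c 0 * d)); first by rewrite ltr_pM2l.
rewrite /d mulrA ler_pdivrMr ?ltr_wpDl //; nra.
Qed.

Lemma geometric_limit : (forall k, continuous (H k)) ->
  exists2 h : T -> R, continuous h & forall k x, `|h x - H k x| <= 2 * c k.
Proof.
move=> Hcont.
have cvgH x : cvg (H^~ x @ \oo).
  apply/cauchy_cvgP/cauchy_exP => e e0.
  have [k ck] := small_index (divr_gt0 e0 (ltr0Sn R 2)).
  exists (H k x); exists k => // j /= kj.
  rewrite /ball /= -(subnKC kj) distrC; apply: le_lt_trans (telescope k _ x) _.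
  by have := c0 k; lra.
have hH k x : `|lim (H^~ x @ \oo) - H k x| <= 2 * c k.
  have cn : (fun j => `|H j x - H k x|) @ \oo --> `|lim (H^~ x @ \oo) - H k x|.
    by apply: cvg_norm; apply: cvgB; [exact: cvgH | exact: cvg_cst].
  rewrite -(cvg_lim _ cn) //; apply: limr_le; first by apply/cvg_ex; eexists;
    exact: cn.
  by exists k => // j /= kj; rewrite -(subnKC kj); exact: telescope.
exists (fun x => lim (H^~ x @ \oo)) => // x.
apply/cvgrPdist_lt => e e0.
(* With [c k < e / 6], the function [H k] is within [e / 3] of the limit at both points, which
   leaves [e / 3] for the continuity of [H k]. *)
have [k ck] := small_index (divr_gt0 e0 (ltr0Sn R 5)).
have e3 : 0 < e / 3 by rewrite divr_gt0.
have := Hcont k x; move/cvgrPdist_lt => /(_ _ e3); apply: filterS => y xy.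
have := hH k x; have := hH k y.
set hx := lim (H^~ x @ \oo); set hy := lim (H^~ y @ \oo) => ky kx.
have := ler_distD (H k x) hx hy; have := ler_distD (H k y) (H k x) hy.
by rewrite [`|H k y - hy|]distrC; lra.
Qed.

End UniformLimit.

Variable X : dynSystem int.
Variables x y : X.
Hypothesis disjoint_orbits : forall n, y <> act n x.

(** By compactness the forward orbit of [x], sampled sparsely, clusters at some [z]; two visits to a
    small neighbourhood of [z] give [n] and [m]. *)
Lemma return_times (h : X -> R) (L k : nat) (e : R) : continuous h -> 0 < e ->
  exists n m, [/\ (n + L <= m)%N, (n < m)%N &
    forall i : int, (`|i| <= k)%N ->
      `|h (act i (act (Posz n) x)) - h (act i (act (Posz m) x))| < e].
Proof.
move=> hc e0.
(* Multiples of [L.+1] keep distinct samples more than [L] apart, even for [L = 0]. *)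
pose u (j : nat) : X := act (Posz (j * L.+1)) x.
have [z [_ zc]] := @space_compact _ X (u @ \oo) _ filterT.
(* The shifts [j - k] with [j <= 2 k] run over all [i] with [|i| <= k]. *)
pose V := [set w : X | forall j : 'I_(2 * k).+1,
  `|h (act (Posz j - Posz k) z) - h (act (Posz j - Posz k) w)| < e / 2].
have e2 : 0 < e / 2 by rewrite divr_gt0.
have Vz : nbhs z V.
  apply: filter_forall => j.
  have := cvg_comp _ _ (@act_continuous _ X (Posz j - Posz k) z) (hc _).
  by move/cvgrPdist_lt => /(_ _ e2).
have visit N : exists2 j, (N <= j)%N & V (u j).
  have FN : (u @ \oo) (u @` [set j | (N <= j)%N]).
    by exists N => // j Nj; exists j.
  by have [_ [[j Nj <-] Vj]] := zc _ _ FN Vz; exists j.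
have [j _ Vj] := visit 0; have [l jl Vl] := visit j.+1.
exists (j * L.+1)%N, (l * L.+1)%N; split; [nia|nia|move=> i ik].
have ik2 : (absz (i + Posz k)%R < (2 * k).+1)%N by lia.
have -> : i = Posz (Ordinal ik2) - Posz k by rewrite /=; lia.
have := Vj (Ordinal ik2); have := Vl (Ordinal ik2).
set i' := (_ - Posz k); rewrite /u.
set a := h (act i' (act _ _)); set b := h (act i' z).
set d := h (act i' (act _ _)).
have := ler_distD b d a; rewrite [`|d - b|]distrC; lra.
Qed.

(** Urysohn's lemma, applied to two finite orbit segments, which are disjoint because the orbits
    are. *)
Lemma bump (n m : nat) : exists b : X -> R, [/\ continuous b,
  forall z, 0 <= b z <= 1 &
  forall i : nat, (n <= i < m)%N ->
    b (act (Posz i) x) = 0 /\ b (act (Posz i) y) = 1].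
Proof.
pose orb (z : X) : set X :=
  (fun i : nat => act (Posz i) z) @` [set i | (n <= i < m)%N].
have clo z : closed (orb z).
  apply: (accessible_finite_set_closed.1
    (hausdorff_accessible (@space_hausdorff _ X))).
  apply: finite_image; apply: (sub_finite_set _ (finite_II m)).
  by move=> i /= /andP[].
have dis : orb x `&` orb y = set0.
  rewrite -subset0 => z [[i _ <-] [j _ /(congr1 (act (- Posz j)))]].
  by rewrite -!actD addNr act0; exact: disjoint_orbits.
have XN := compact_normal (@space_hausdorff _ X) (@space_compact _ X).
have us := (@normal_separatorP R X).1 XN (orb x) (orb y) (clo x) (clo y) dis.
have [b [bc b01 bx by1]] := (@uniform_separatorP X R _ _).1 us.
exists b; split=> //.
- by move=> z; have /b01 := imageT b z; rewrite /= in_itv.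
- move=> i im; split.
  + by apply: bx; exists (act (Posz i) x) => //; exists i.
  + by apply: by1; exists (act (Posz i) y) => //; exists i.
Qed.

(** For [phi = exp (i h)] this is an argument of the product of [phi(T^i y) / phi(T^i x)] over
    [n <= i < m]. *)
Definition drift (h : X -> R) (n m : nat) : R :=
  \sum_(n <= i < m) (h (act (Posz i) y) - h (act (Posz i) x)).

(** Half a turn of the drift can be spread over the [m - n] times of the window, so a long window
    costs only a small change of [h]. *)
Lemma hump (h : X -> R) (n m : nat) : continuous h -> (n < m)%N ->
  exists g : X -> R, [/\ continuous g,
    forall z, `|g z - h z| <= pi / (m - n)%:R & cos (drift g n m) <= 0].
Proof.
move=> hc nm; have mn0 : 0 < (m - n)%:R :> R by rewrite ltr0n subn_gt0.
have p0 : 0 <= pi / (m - n)%:R :> R by rewrite divr_ge0 ?pi_ge0 // ltW.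
have [dneg|dpos] := leP (cos (drift h n m)) 0.
  by exists h; split=> // z; rewrite subrr normr0.
(* Adding [pi / (m - n) * b] shifts the drift by [pi]. *)
have [b [bc b01 bE]] := bump n m.
exists (fun z => h z + pi / (m - n)%:R * b z); split.
- move=> z; apply: cvgD; first exact: hc.
  by apply: cvgM; [exact: cvg_cst | exact: bc].
- move=> z; rewrite addrC addKr normrM (ger0_norm p0) ler_piMr //.
  by have /andP[b0 b1] := b01 z; rewrite ger0_norm.
have -> : drift (fun z => h z + pi / (m - n)%:R * b z) n m = drift h n m + pi.
  rewrite /drift.
  have pE : \sum_(n <= i < m) (pi / (m - n)%:R) = pi :> R.
    by rewrite sumr_const_nat -[LHS]mulr_natr divfK // gt_eqF.
  rewrite -[X in _ = _ + X]pE -big_split /=; apply: eq_big_nat => i im.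
  by have [b0 b1] := bE i im; rewrite b0 b1; ring.
by rewrite cosDpi; lra.
Qed.

Lemma drift_close (h g : X -> R) (n m : nat) (e : R) : (n <= m)%N ->
  (forall z, `|h z - g z| <= e) ->
  `|drift h n m - drift g n m| <= 2 * e * (m - n)%:R.
Proof.
move=> nm hg; rewrite /drift -sumrB.
apply: le_trans (ler_norm_sum _ _ _) _.
apply: (@le_trans _ _ (\sum_(n <= i < m) (2 * e))).
  apply: ler_sum_nat => i _.
  have := hg (act (Posz i) y); have := hg (act (Posz i) x).
  set a := h _; set b := g _; set c := h _; set d := g _ => ab cd.
  have -> : c - a - (d - b) = (c - d) - (a - b) by ring.
  by apply: le_trans (ler_normB _ _) _; lra.
by rewrite sumr_const_nat mulr_natr.
Qed.

(** Windows are chosen one after another, each at return times of the current function, which [hump]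
    then corrects. Each is at least 100 times as long as the previous one, so all later corrections
    together barely affect the earlier windows. *)
Lemma gliding_hump : exists (h : X -> R) (n m : nat -> nat),
  [/\ continuous h, forall k, (n k <= m k)%N,
    forall i : int,
      (fun k => h (act i (act (Posz (n k)) x)) - h (act i (act (Posz (m k)) x)))
        @ \oo --> (0 : R) &
    forall k, cos (drift h (n k) (m k)) <= 1 / 2].
Proof.
(* A state is [(k, h_k, (n_k, m_k))]. *)
pose state := (nat * (X -> R) * (nat * nat))%type.
pose len (s : state) := (s.2.2 - s.2.1)%N.
(* The invariant is a premise of [step] because [dependent_choice] wants a successor of every state;
   a state violating it succeeds itself vacuously. *)
pose step (s t : state) := continuous s.1.2 -> (s.2.1 < s.2.2)%N ->
  [/\ t.1.1 = s.1.1.+1, continuous t.1.2,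
      (t.2.1 < t.2.2)%N /\ (100 * len s <= len t)%N,
      (forall i : int, (`|i| <= s.1.1)%N ->
        `|s.1.2 (act i (act (Posz t.2.1) x))
          - s.1.2 (act i (act (Posz t.2.2) x))| < s.1.1.+1%:R^-1) &
      (forall z, `|t.1.2 z - s.1.2 z| <= pi / (len t)%:R) /\
      cos (drift t.1.2 t.2.1 t.2.2) <= 0].
have stepP s : {t | step s t}.
  apply: cid; have [sc|nsc] := pselect (continuous s.1.2 /\ (s.2.1 < s.2.2)%N).
    have [hc s0] := sc.
    have e0 : 0 < s.1.1.+1%:R^-1 :> R by rewrite invr_gt0.
    have [n [m [Lm nm close]]] := return_times (100 * len s) s.1.1 hc e0.
    have [g [gc gh cg]] := hump hc nm.
    exists (s.1.1.+1, g, (n, m)) => _ _; split=> //=; split=> //.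
    by rewrite /len /= in Lm *; lia.
  by exists s => hc s0; case: nsc.
have [s [s0 sS]] := dependent_choice stepP (0%N, (cst 0 : X -> R), (0%N, 1%N)).
have inv k :
    [/\ (s k).1.1 = k, continuous (s k).1.2 & ((s k).2.1 < (s k).2.2)%N].
  elim: k => [|k [k1 k2 k3]]; first by rewrite s0; split=> // z; exact: cvg_cst.
  by have [-> ? [? _] _ _] := sS k k2 k3; split; rewrite ?k1.
have {}sS k : [/\ (100 * len (s k) <= len (s k.+1))%N,
    (forall i : int, (`|i| <= k)%N ->
      `|(s k).1.2 (act i (act (Posz (s k.+1).2.1) x))
        - (s k).1.2 (act i (act (Posz (s k.+1).2.2) x))| < k.+1%:R^-1),
    (forall z, `|(s k.+1).1.2 z - (s k).1.2 z| <= pi / (len (s k.+1))%:R) &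
    cos (drift (s k.+1).1.2 (s k.+1).2.1 (s k.+1).2.2) <= 0].
  have [k1 k2 k3] := inv k; have := sS k k2 k3.
  by rewrite k1 => -[_ _ [_ ?] ? []].
have len_gt0 k : (0 < len (s k))%N by have [_ _] := inv k; rewrite subn_gt0.
have len_ge k : (k.+1 <= len (s k))%N.
  by elim: k => // k IH; have [+ _ _ _] := sS k; lia.
have l0 k : 0 < (len (s k))%:R :> R by rewrite ltr0n.
have l100 k : 100 * (len (s k))%:R <= (len (s k.+1))%:R :> R.
  by have [+ _ _ _] := sS k; rewrite -natrM ler_nat.
pose c k : R := pi / (len (s k.+1))%:R.
have cge0 k : 0 <= c k by rewrite divr_ge0 ?pi_ge0.
have c100 k : 100 * c k.+1 <= c k.
  rewrite /c ler_pdivlMr // mulrA mulrAC ler_pdivrMr //.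
  by have := l100 k.+1; have := pi_ge0 R; nra.
have c2 k : 2 * c k.+1 <= c k by have := c100 k; have := cge0 k.+1; lra.
have Hc k z : `|(s k.+1).1.2 z - (s k).1.2 z| <= c k by have [_ _ + _] := sS k.
have [h hc hH] := geometric_limit cge0 c2 Hc
  (fun k => let: And3 _ B _ := inv k in B).
have pi4 : (pi : R) < 4 by have := pihalf_lt2 R; lra.
(* The windows are read from stage 1 on: the initial one, where the function is 0, has drift 0 and
   cosine 1. *)
exists h, (fun k => (s k.+1).2.1), (fun k => (s k.+1).2.2); split=> //.
- by move=> k; have [_ _ /ltnW] := inv k.+1.
- move=> i; apply/cvgrPdist_lt => e e0.
  (* Replacing [h] by [h_k] at both points costs at most [4 * c k], hence [16 / (k + 1)]; the return
     times of [h_k] contribute one more [1 / (k + 1)]. *)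
  have e17 : 0 < e / 17 by rewrite divr_gt0.
  have [N _ NP] := near_infty_natSinv_lt (PosNum e17).
  exists (maxn N `|i|%N) => // k /=; rewrite geq_max => /andP[Nk ik].
  have ke : k.+1%:R^-1 < e / 17 := NP k Nk.
  have [_ /(_ i ik) close _ _] := sS k.
  rewrite sub0r normrN.
  have := hH k (act i (act (Posz (s k.+1).2.1) x)).
  have := hH k (act i (act (Posz (s k.+1).2.2) x)).
  move: close; set b := h _; set a := h _.
  set a' := (s k).1.2 _; set b' := (s k).1.2 _ => a'b' bb aa.
  have ck : c k <= 4 * k.+1%:R^-1.
    rewrite /c ler_pM ?pi_ge0 ?invr_ge0 ?(ltW pi4) // lef_pV2 ?posrE ?ltr0n //.
    by rewrite ler_nat (leq_trans (len_ge k)) //; have [+ _ _ _] := sS k; lia.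
  have := ler_distD a' a b; have := ler_distD b' a' b.
  rewrite [`|b' - b|]distrC; move: ke a'b' ck; set d := k.+1%:R^-1; lra.
- move=> k; have [_ _ _ ck] := sS k.
  have [_ _ /ltnW nm] := inv k.+1.
  (* Later corrections move this drift by at most [4 * c k.+1] times the length of the window, that
     is by at most 16/100; the cosine, initially at most 0, stays below 1/2. *)
  have := drift_close nm (hH k.+1).
  set A := drift h _ _; set B := drift _ _ _ in ck *.
  rewrite -/(len (s k.+1)) => AB.
  have lc : c k.+1 * (len (s k.+1))%:R <= 4 / 100.
    have -> : (len (s k.+1))%:R = pi / c k :> R.
      by rewrite /c invfM invrK mulrA divff ?mul1r // gt_eqF ?pi_gt0.
    have c0 : 0 < c k by rewrite divr_gt0 ?pi_gt0.
    rewrite mulrA ler_pdivrMr //; have := c100 k; have := cge0 k.+1.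
    have := pi_ge0 R; nra.
  have := cos_lipschitz A B.
  have E : 2 * (2 * c k.+1) * (len (s k.+1))%:R =
    4 * (c k.+1 * (len (s k.+1))%:R) by ring.
  rewrite E in AB; have := ler_norm (cos A - cos B); lra.
Qed.

End GlidingHump.

(** * Central elements over the integers *)

Section Limits.
Variables (C : numClosedFieldType) (Gamma : zmodType).
Local Notation D := (gelfand C Gamma).
Local Notation alg := (distal_alg C Gamma).

Lemma ultra_cluster_cvg (I : Type) (W : set_system I) (T : topologicalType)
    (u : I -> T) (z : T) :
  UltraFilter W -> cluster (u @ W) z -> u @ W --> z.
Proof.
move=> WU cz A Az.
have [//|WnA] := in_ultra_setVsetC (u @^-1` A) WU.
by have [t [nAt At]] := cz _ _ (WnA : (u @ W) (~` A)) Az.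
Qed.

Lemma distal_function_ultra_cvg (I : Type) (W : set_system I) (g : I -> Gamma)
    (f : alg) :
  UltraFilter W -> exists l : C, (fun i => sval f (g i)) @ W --> l.
Proof.
move=> WU; have [X [x0 [F [_ Fc fE]]]] := set_mem (svalP f).
have [z [_ cz]] := @space_compact _ X ((fun i => act (g i) x0) @ W)
  (fmap_proper_filter _ ultra_proper) filterT.
exists (F z); under eq_fun do rewrite fE.
exact: (cvg_comp _ _ (ultra_cluster_cvg WU cz) (Fc z)).
Qed.

(** A distal function factors through a compact space, so its values converge along an ultrafilter,
    and the identities of a character pass to the limit. *)
Lemma ultra_limit (I : Type) (W : set_system I) (g : I -> Gamma) :
  UltraFilter W ->
  exists q : D, forall f, (fun i => sval f (g i)) @ W --> pairing q f.
Proof.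
move=> WU; have [q qP] := choice (fun f => distal_function_ultra_cvg g f WU).
have WF := @ultra_proper _ _ WU.
suff cq : is_character q by exists (Gelfand cq).
have uniq (u : I -> C) (a b : C) : u @ W --> a -> u @ W --> b -> a = b.
  exact: (cvg_unique (@norm_hausdorff _ C)).
split=> [a f f'|].
  apply: (uniq _ _ _ (qP _)).
  exact: (cvgD (cvgM (cvg_cst a) (qP f)) (qP f')).
split; first by apply: (uniq _ _ _ (qP _)); exact: cvg_cst.
by move=> f f'; apply: (uniq _ _ _ (qP _)); exact: (cvgM (qP f) (qP f')).
Qed.

(* [y] is [p x], the limit of [act g x] as the image of [g] tends to [p]. *)
Definition is_limit_point (p : D) (X : dynSystem Gamma) (dX : distal_system X)
    (x y : X) : Prop :=
  forall (F : X -> C) (Fc : continuous F), pairing p (orbit_fun dX x Fc) = F y.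

(** The value of [q] on the translate by [g] is that of [F \o act g] at the limit point: convolving
    by [q] moves the base point from [x] to [q x]. *)
Lemma convolution_orbit (q : D) X (dX : distal_system X) (x z : X)
    (F : X -> C) (Fc : continuous F) :
  is_limit_point q dX x z ->
  convolution q (orbit_fun dX x Fc) = orbit_fun dX z Fc.
Proof.
move=> qz; apply: val_inj; apply/funext => g.
have Fgc : continuous (F \o act g).
  by move=> w; exact: (continuous_comp (@act_continuous _ X g w) (Fc _)).
apply: (@etrans _ _ (pairing q (orbit_fun dX x Fgc))); last exact: qz.
rewrite /=; congr (pairing q _).
by apply: val_inj; apply/funext => h /=; rewrite actD.
Qed.

(** This is [p (q x) = q (p x)] read through [F], from [p q = q p] evaluated on the orbit function
    of [x]. *)
Lemma commuting_limit_points (p q : D) X (dX : distal_system X) (x y z : X) :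
  gelfand_mul p q = gelfand_mul q p ->
  is_limit_point p dX x y -> is_limit_point q dX x z ->
  forall (F : X -> C) (Fc : continuous F),
    pairing p (orbit_fun dX z Fc) = pairing q (orbit_fun dX y Fc).
Proof.
move=> pq py qz F Fc.
rewrite -(convolution_orbit Fc py) -(convolution_orbit Fc qz).
exact: (congr1 (fun r => pairing r (orbit_fun dX x Fc)) pq).
Qed.

End Limits.

Section IntegerCenter.
Variables (R : realType) (C : numClosedFieldType).
Hypothesis compactC : compact [set z : C | `|z| = 1].
(* [E] stands for [fun t => exp (i t)]. *)
Variable E : R -> circle C.
Hypothesis Ec : continuous E.
Hypothesis ED : forall s t, sval (E (s + t)) = sval (E s) * sval (E t).
Hypothesis E_far : forall t, cos t <= 1 / 2 -> 1 / 2 <= `|sval (E t) - 1|.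
Local Notation D := (gelfand C int).

Lemma E0 : sval (E 0) = 1.
Proof.
have := ED 0 0; rewrite addr0 => /esym/eqP.
rewrite -[X in _ == X]mulr1 => /eqP /(mulfI (circle_neq0 (E 0))) //.
Qed.

Lemma EN t : sval (E (- t)) = (sval (E t))^-1.
Proof.
apply: (mulfI (circle_neq0 (E t))).
by rewrite -ED subrr E0 divff // circle_neq0.
Qed.

Lemma E_sum (n m : nat) (h : nat -> R) :
  sval (E (\sum_(n <= i < m) h i)) = \prod_(n <= i < m) sval (E (h i)).
Proof.
by apply: (big_morph (fun t => sval (E t))); [exact: ED | exact: E0].
Qed.

Lemma cocycle_ext (X : dynSystem int) (phi : X -> circle C) (z z' : X) :
  (forall i, sval (phi (act i z)) = sval (phi (act i z'))) ->
  forall n, cocycle phi n z = cocycle phi n z'.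
Proof.
by move=> zz' [n|n]; rewrite /=; [|congr (_^-1)]; apply: eq_bigr => i _.
Qed.

Lemma cocycle_nat (X : dynSystem int) (phi : X -> circle C) (n m : nat)
    (z : X) :
  (n <= m)%N -> cocycle phi (Posz m) z =
    cocycle phi (Posz n) z * \prod_(n <= i < m) sval (phi (act (Posz i) z)).
Proof.
move=> nm /=.
rewrite -!(big_mkord xpredT (fun i => sval (phi (act (Posz i) z)))).
by rewrite -big_cat_nat.
Qed.

Lemma circle1_subproof : `|1 : C| = 1.
Proof. exact: normr1. Qed.

Definition circle1 : circle C := Circle circle1_subproof.

Lemma central_limit_point (p : D) (X : dynSystem int) (dX : distal_system X)
    (x y : X) :
  (forall q, gelfand_mul p q = gelfand_mul q p) -> is_limit_point p dX x y ->
  exists n, y = act n x.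
Proof.
move=> pc py; apply: contrapT => nyx.
have disj n : y <> act n x by move=> yx; apply: nyx; exists n.
have [h [n [m [hc nm close far]]]] := @gliding_hump R X x y disj.
pose phi (w : X) := E (h w).
have phic : continuous phi.
  by move=> w; exact: (cvg_comp _ _ (hc w) (@Ec (h w))).
pose Y := skew_product compactC phic.
have dY : distal_system Y := @skew_distal C compactC X phi phic dX.
pose base (w : X) : Y := (w, circle1).
have [[y' c] pyc] := gelfand_point p dY (base x).
have FXc (F : X -> C) : continuous F -> continuous (fun w : Y => F w.1).
  by move=> Fc [w u]; apply: (cvg_comp _ _ cvg_fst); exact: Fc.
have fstE q (F : X -> C) (Fc : continuous F) :
    pairing q (orbit_fun dY (base x) (FXc F Fc)) =
    pairing q (orbit_fun dX x Fc).
  by congr (pairing q _); apply: val_inj.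
have sndc : continuous (fun w : Y => sval w.2).
  by move=> [w u]; apply: (cvg_comp _ _ cvg_snd); exact: continuous_sval.
pose B w := orbit_fun dY (base w) sndc.
have BE w k : sval (B w) k = cocycle phi k w by exact: mulr1.
have orbitE w u : orbit_fun dY ((w, u) : Y) sndc = sval u *: B w.
  have comm (a b : C) : a * b = b * (a * 1) by rewrite mulr1 mulrC.
  by apply: val_inj; apply/funext => k; exact: comm.
(* Both [y'] and [y] are limits of [x] under [p], so continuous functions on [X], in particular the
   cocycles, agree at them. *)
have y'E k : cocycle phi k y' = cocycle phi k y.
  have cc := @continuous_cocycle C X phi phic k.
  by rewrite -(pyc _ (FXc _ cc)) fstE py.
have Bext w w' : (forall k, cocycle phi k w = cocycle phi k w') -> B w = B w'.
  move=> ww'; apply: val_inj; apply/funext => k.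
  exact: (etrans (BE w k) (etrans (ww' k) (esym (BE w' k)))).
have By' := Bext _ _ y'E.
(* Evaluate [p q = q p] at [B x]; the right-hand side for [q] and for [q'] below
   involves the same [pairing p (B z)] once [q x = q' x]. *)
have key q z d : is_limit_point q dY (base x) (z, d) ->
    pairing q (B x) * pairing p (B z) = sval c * pairing q (B y).
  move=> qzd; have := commuting_limit_points (pc q) pyc qzd sndc.
  by rewrite !orbitE !pairingZ By' -(qzd _ sndc).
(* Along an ultrafilter refining [\oo] both sequences of times converge in [D], to [q] and [q']. *)
have [W [WU ooW]] := @ultraFilterLemma nat \oo _.
have WF := @ultra_proper _ _ WU.
have [q qP] := @ultra_limit C int nat W (fun k => Posz (n k)) WU.
have [q' q'P] := @ultra_limit C int nat W (fun k => Posz (m k)) WU.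
have [[z d] qzd] := gelfand_point q dY (base x).
have [[z' d'] q'zd] := gelfand_point q' dY (base x).
(* The values of [h] after [n k] and [m k] steps, shifted by any fixed [i], become equal in the
   limit; hence [phi] agrees along the orbits of [z] and [z']. *)
have Bz : B z = B z'.
  apply: Bext; apply: cocycle_ext => i.
  have phiic : continuous (fun w => sval (phi (act i w)) : C).
    move=> w; have H := continuous_comp (@act_continuous _ X i w) (phic _).
    exact: (continuous_comp H (@continuous_sval _ _)).
  have lq := qP (orbit_fun dX x phiic); have lq' := q'P (orbit_fun dX x phiic).
  rewrite -fstE qzd /= in lq; rewrite -fstE q'zd /= in lq'.
  have e1 : (fun k => sval (E (h (act i (act (Posz (n k)) x))
      - h (act i (act (Posz (m k)) x)))) : C) @ W --> sval (E 0).
    have H1 := cvg_comp _ _ (close i) (@Ec 0).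
    have H2 := cvg_comp _ _ H1 (@continuous_sval _ (E 0)).
    by move=> A /H2; exact: ooW.
  rewrite E0 in e1.
  have l := cvgM e1 lq'; rewrite mul1r in l.
  apply: (cvg_unique (@norm_hausdorff _ C) lq).
  suff <- : (fun k => sval (E (h (act i (act (Posz (n k)) x))
      - h (act i (act (Posz (m k)) x))))
      * sval (phi (act i (act (Posz (m k)) x)))) =
      (fun k => sval (phi (act i (act (Posz (n k)) x)))) by exact: l.
  by apply/funext => j; rewrite -ED subrK.
(* Cross-multiplying the two instances of [key] eliminates [pairing p (B z)], and [sval c]
   cancels. *)
have eqq :
    pairing q (B y) * pairing q' (B x) = pairing q' (B y) * pairing q (B x).
  have k1 := key _ _ _ qzd; have k2 := key _ _ _ q'zd.
  suff : sval c * (pairing q (B y) * pairing q' (B x)) =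
      sval c * (pairing q' (B y) * pairing q (B x)).
    by move/(mulfI (circle_neq0 c)).
  by rewrite !mulrA -k1 -k2 Bz; ring.
have l1 := @cvgM _ _ _ WF _ _ _ _ (qP (B y)) (q'P (B x)).
have l2 := @cvgM _ _ _ WF _ _ _ _ (q'P (B y)) (qP (B x)).
have l := @cvgB _ _ _ _ WF _ _ _ _ l1 l2; rewrite eqq subrr in l.
(* The difference tends to 0 along [W], yet its modulus is [|Pv / Pu - 1|], which [E_far] keeps at
   least 1/2. *)
have : \forall k \near W,
  `|0 - (sval (B y) (Posz (n k)) * sval (B x) (Posz (m k))
    - sval (B y) (Posz (m k)) * sval (B x) (Posz (n k)))| < 1 / 2.
  have h2 : (0 : C) < 1 / 2 by rewrite divr_gt0.
  exact: ((@cvgrPdist_lt C C _ W _ _ _).1 l _ h2).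
move=> /filter_ex[k]; rewrite sub0r normrN !BE !(cocycle_nat _ _ (nm k)).
set V := cocycle phi _ y; set U := cocycle phi _ x.
set Pu := \prod_(_ <= _ < _) sval (phi (act _ x)).
set Pv := \prod_(_ <= _ < _) _.
have Pu1 : `|Pu| = 1 by rewrite normr_prod big1 // => i _; exact: circle_norm.
have driftE : sval (E (drift x y h (n k) (m k))) = Pv / Pu.
  rewrite E_sum -prodf_div; apply: eq_bigr => i _.
  by rewrite ED EN.
have := E_far (far k); rewrite driftE.
have -> : V * (U * Pu) - V * Pv * U = - (V * U) * (Pv - Pu) by ring.
have Pu0 : Pu != 0 by rewrite -normr_gt0 Pu1.
have -> : Pv / Pu - 1 = (Pv - Pu) / Pu by field.
rewrite !normrM normrN normfV Pu1 invr1 mulr1 normrM !cocycle_norm !mul1r.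
by move=> /le_lt_trans H /H; rewrite ltxx.
Qed.

Lemma cocycle_cst (lam : circle C) (X : dynSystem int) (n : int) (x : X) :
  cocycle (fun=> lam) n x = sval lam ^ n.
Proof. by case: n => n; rewrite /= prodr_const card_ord. Qed.

Lemma central_canonical (lam : circle C) (p : D) :
  (forall n m : int, sval lam ^ n = sval lam ^ m -> n = m) ->
  (forall q, gelfand_mul p q = gelfand_mul q p) ->
  exists n, p = canonical_map C n.
Proof.
move=> lam_inj pc.
pose rotation (e : distal_alg C int) := forall k, sval e k = sval lam ^ k.
have key (f : distal_alg C int) : exists n e,
    [/\ pairing p f = sval f n, rotation e & pairing p e = sval lam ^ n].
  have [X [x [F [dX Fc fE]]]] := set_mem (svalP f).
  (* The skew product by the constant [lam] is the product of [X] with a rotation, whose orbit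
     function records the exponent [n]. *)
  have lamc : continuous (fun _ : X => lam) by move=> w; exact: cvg_cst.
  pose Y := skew_product compactC lamc.
  have dY : distal_system Y := @skew_distal C compactC X _ lamc dX.
  have [y py] := gelfand_point p dY ((x, circle1) : Y).
  have [n yn] := central_limit_point pc py.
  have fstc : continuous (fun w : Y => F w.1).
    by move=> [w u]; apply: (cvg_comp _ _ cvg_fst); exact: Fc.
  have sndc : continuous (fun w : Y => sval w.2).
    by move=> [w u]; apply: (cvg_comp _ _ cvg_snd); exact: continuous_sval.
  have rE k : cocycle (fun=> lam) k x * 1 = sval lam ^ k.
    by rewrite mulr1 cocycle_cst.
  exists n, (orbit_fun dY ((x, circle1) : Y) sndc); split.
  - have -> : f = orbit_fun dY ((x, circle1) : Y) fstc.
      by apply: val_inj; apply/funext => g; exact: fE.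
    by rewrite py yn.
  - by move=> k; exact: rE.
  - by rewrite py yn; exact: rE.
(* The rotation function is the same for every [f], so [pairing p e = lam ^ n] pins down one common
   exponent. *)
have [n0 [e0 [_ r0 p0]]] := key 0.
exists n0; apply: gelfand_ext => f; have [n [e [-> r pe]]] := key f.
have ee0 : e = e0.
  by apply: val_inj; apply/funext => k; exact: (etrans (r k) (esym (r0 k))).
by have <- : n = n0 by apply: lam_inj; rewrite -pe -p0 ee0.
Qed.

End IntegerCenter.

(** * The complex exponential and a rotation of infinite order *)

Section Complex.
Variable R : realType.
Local Notation C := (R[i] : numClosedFieldType).

Lemma cis_norm (t : R) : `|(cos t +i* sin t : C)| = 1.
Proof. by rewrite normc_def /= cos2Dsin2 sqrtr1. Qed.

Definition cis (t : R) : circle C := Circle (cis_norm t).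

Lemma continuous_cis : continuous cis.
Proof.
apply: continuous_circle.
apply: continuous_complex; first exact: continuous_cos.
exact: continuous_sin.
Qed.

Lemma cisD s t : sval (cis (s + t)) = sval (cis s) * sval (cis t).
Proof.
apply/eqP; rewrite eq_complex /= cosD sinD; apply/andP; split=> //.
by rewrite addrC.
Qed.

(** The real part of [cis t - 1] alone has modulus at least [1 - cos t]. *)
Lemma cis_far t : cos t <= 1 / 2 -> 1 / 2 <= `|sval (cis t) - 1|.
Proof.
move=> ct; have -> : (1 / 2 : C) = (1 / 2 : R)%:C.
  by rewrite rmorphM fmorphV rmorph_nat.
apply: le_trans (normc_ge_Re _); rewrite lecR /= ler_normr.
by apply/orP; right; lra.
Qed.

Lemma rot345_norm : `|(3 / 5 +i* (4 / 5) : C)| = 1.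
Proof.
rewrite normc_def /= (_ : _ + _ = 1) ?sqrtr1 //.
by field.
Qed.

Definition rot345 : circle C := Circle rot345_norm.

(* [(3 + 4i) ^+ n] is congruent to [3 + 4i] modulo 5, hence never equal to
   [5 ^+ n]. *)
Lemma rot345_pow (n : nat) : exists a b : int,
  sval rot345 ^+ n.+1 * 5 ^+ n.+1 =
    ((5 * a + 3)%:~R +i* (5 * b + 4)%:~R : C).
Proof.
elim: n => [|n [a [b IH]]].
  exists 0, 0; apply/eqP; rewrite eq_complex !expr1 /=.
  by apply/andP; split; apply/eqP; field.
(* Obtained by expanding [(3 + 4i) ((5a + 3) + (5b + 4)i)]. *)
exists (3 * a - 4 * b - 2), (4 * a + 3 * b + 4).
rewrite [_ ^+ n.+2]exprS [5 ^+ n.+2]exprS mulrACA IH.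
apply/eqP; rewrite eq_complex /=; apply/andP; split; apply/eqP.
  by rewrite !(rmorphD, rmorphB, rmorphM) /=; field.
by rewrite !(rmorphD, rmorphB, rmorphM) /=; field.
Qed.

Lemma rot345_inj (n m : int) :
  sval rot345 ^ n = sval rot345 ^ m -> n = m.
Proof.
have pow1 (k : nat) : sval rot345 ^+ k = 1 -> k = 0%N.
  case: k => // k; have [a [b]] := rot345_pow k => + k1.
  have -> : (5 : C) = (5 : R)%:C by rewrite rmorph_nat.
  (* A power equal to 1 would make the imaginary part [5b + 4] vanish, which is impossible modulo
     5. *)
  rewrite k1 mul1r -rmorphXn /= => /(congr1 (@complex.Im R)) /= /esym/eqP.
  by rewrite intr_eq0 => /eqP; lia.
have l0 := circle_neq0 rot345.
wlog nm : n m / n <= m.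
  by move=> H; have [|/ltW] := leP n m => [/H|/H + /esym] => /[apply].
move=> e; have : sval rot345 ^ (m - n) = 1.
  by apply: (mulfI (expfz_neq0 n l0)); rewrite -expfzDr // mulr1 addrC subrK.
have [k kE] : exists k : nat, m - n = Posz k by exists (absz (m - n)); lia.
by rewrite kE => /pow1; lia.
Qed.

End Complex.

Theorem theorem3p1 (R : realType) :
  (forall (Gamma : zmodType)
      (mul : gelfand R[i] Gamma -> gelfand R[i] Gamma -> gelfand R[i] Gamma),
    infinite_set [set: Gamma] -> is_gelfand_mul mul ->
    topological_center mul = algebraic_center mul)
  /\
  (forall mul : gelfand R[i] int -> gelfand R[i] int -> gelfand R[i] int,
    is_gelfand_mul mul ->
    algebraic_center mul = range (@canonical_map R[i] int)).
Proof.
split=> [Gamma mul _ mulP|mul mulP]; first exact: topological_center_algebraic.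
apply/seteqP; split=> [p pc|]; last exact: canonical_map_central.
have pc' q : gelfand_mul p q = gelfand_mul q p by rewrite -!(mulE mulP).
have [n ->] := central_canonical (@compact_unit_circle R) (@continuous_cis R)
  (@cisD R) (@cis_far R) (@rot345_inj R) pc'.
by exists n.
Qed.
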